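(* On the modal structure $\mu[\mathcal{S}]$ built from Scott's graph model $\mathcal{S}$, the negated atomics are not stable, and in particular the negated atomic $x\neq y$ is not stable: the sentence $\Box\,[\forall x,y\,(x\neq y\Rightarrow\Box(x\neq y))]$ is not valid on $\mu[\mathcal{S}]$.
   Context: Scott's graph model $\mathcal{S}$. Its underlying set is $P(\omega)$. Let $d_0,d_1,d_2,\ldots$ be a standard fixed enumeration of the finite subsets of $\omega$ and $\langle\cdot,\cdot\rangle:\omega\times\omega\to\omega$ a computable bijection. Application is the total operation $ab=\{m:\exists n\;(\langle n,m\rangle\in a\wedge d_n\subseteq b)\}$. This is a partial combinatory algebra (pca), i.e. there are $k,s$ with $kab=a$, $sabc=ac(bc)$ for all $a,b,c$ (application associates to the left). Fix a pairing $p$ and projections $p_0,p_1$ in $\mathcal{S}$ with $p_0(pab)=a$, $p_1(pab)=b$, and $\breve{k}$ with $\breve{k}ab=b$. Truth values. Write $\mathcal{A}=\mathcal{S}$. For $X,Y\subseteq\mathcal{A}$: $X\wedge Y=\{pab:a\in X,b\in Y\}$, $X\vee Y=\{pka:a\in X\}\cup\{p\breve{k}b:b\in Y\}$, $X\Rightarrow Y=\{e:\forall a\in X\;ea\in Y\}$, $\bot=\emptyset$, $\top=\mathcal{A}$. For $D\subseteq\mathcal{A}$ put $\ominus_DX=(X\Rightarrow D)\Rightarrow D$. Structure. The signature $L$ has constants $s,k$ and a binary function symbol for application. $\mathcal{S}$ is viewed as a $P(\mathcal{S})$-valued $L$-structure with domain $\mathcal{S}$, the standard interpretations of $s$, $k$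 and application, identity valued by $\|a=b\|=\top$ if $a=b$ and $\bot$ otherwise, and quantifier $\mathbb{Q}(x)=\{x\}$. Modal valuation $\mu[\mathcal{S}]$. For each modal $L$-formula $\varphi(\overline{x})$, tuple $\overline{a}$ from $\mathcal{S}$ and $D\subseteq\mathcal{A}$, define $\|\varphi(\overline{a})\|_\mu(D)\subseteq\mathcal{A}$ by: atomic $\varphi$: $\ominus_D\|\varphi(\overline{a})\|$; $\bot$: $\ominus_D\bot$; $\wedge$ and $\Rightarrow$ are computed by the operations $\wedge,\Rightarrow$ above (and $\neg\varphi$ is $\varphi\Rightarrow\bot$); $\|\varphi\vee\psi\|_\mu(D)=\ominus_D(\|\varphi\|_\mu(D)\vee\|\psi\|_\mu(D))$; $\|\exists z\,\varphi(z)\|_\mu(D)=\ominus_D\bigcup_{c\in\mathcal{S}}[\mathbb{Q}(c)\wedge\|\varphi(c)\|_\mu(D)]$; $\|\forall z\,\varphi(z)\|_\mu(D)=\bigcap_{c\in\mathcal{S}}[\mathbb{Q}(c)\Rightarrow\|\varphi(c)\|_\mu(D)]$; $\|\Box\varphi\|_\mu(D)=\ominus_D\bigcap_{E\subseteq\mathcal{A}}\|\varphi\|_\mu(E)$. A sentence $\varphi$ is valid if there is $e\in\mathcal{A}$ with $e\in(\top\Rightarrow\|\varphi\|_\mu(D))$ for all $D\subseteq\mathcal{A}$. A formula $\varphi(\overline{x})$ is stable if $\Box[\forall\overline{x}\,(\varphi(\overline{x})\Rightarrow\Box\,\varphi(\overline{x}))]$ is valid. *)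

(* Defs.v *)
From mathcomp Require Import all_boot all_classical.

Set Implicit Arguments.
Unset Strict Implicit.
Unset Printing Implicit Defensive.

Local Open Scope classical_set_scope.

(** * Scott's graph model *)

(* Only the range of the enumeration of the finite subsets of [nat] and the
   bijectivity of the pairing enter the definition of the model, so these are
   the only properties recorded: any standard enumeration and any computable
   bijection give a [coding]. *)
Record coding := Coding {
  dset : nat -> set nat;
  dsetP : range dset = [set X | finite_set X];
  code : nat * nat -> nat;
  code_bij : bijective code }.

Definition carrier := set nat.

Definition app (C : coding) (a b : carrier) : carrier :=
  [set m | exists n, a (code C (n, m)) /\ dset C n `<=` b].

(* An arbitrary choice of the elements k, s, p, p0, p1 and k-breve. *)
Record combinators (C : coding) := Combinators {
  ck : carrier;
  cs : carrier;
  cp : carrier;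
  cp0 : carrier;
  cp1 : carrier;
  ckb : carrier;
  ckP : forall a b, app C (app C ck a) b = a;
  csP : forall a b c,
    app C (app C (app C cs a) b) c = app C (app C a c) (app C b c);
  cp0P : forall a b, app C cp0 (app C (app C cp a) b) = a;
  cp1P : forall a b, app C cp1 (app C (app C cp a) b) = b;
  ckbP : forall a b, app C (app C ckb a) b = b }.

(** * Truth values *)

Definition tval := set carrier.

Definition tbot : tval := set0.
Definition ttop : tval := setT.

Section TruthValues.
Variables (C : coding) (K : combinators C).

Definition tpair (a b : carrier) : carrier := app C (app C (cp K) a) b.

Definition tand (X Y : tval) : tval :=
  [set c | exists a b, [/\ X a, Y b & c = tpair a b]].

Definition tor (X Y : tval) : tval :=
  [set tpair (ck K) a | a in X] `|` [set tpair (ckb K) b | b in Y].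

Definition timp (X Y : tval) : tval :=
  [set e | forall a, X a -> Y (app C e a)].

Definition ominus (D X : tval) : tval := timp (timp X D) D.

End TruthValues.

(** * Modal formulas *)

(* [formula n] is the type of formulas with free variables among [n] de Bruijn
   indices; a quantifier binds index 0, so the sentences are the elements of
   [formula 0]. *)
Inductive term (n : nat) : Type :=
  | TVar of 'I_n
  | TS
  | TK
  | TApp of term n & term n.

Arguments TS {n}.
Arguments TK {n}.

Inductive formula : nat -> Type :=
  | FEq n of term n & term n : formula n
  | FBot n : formula n
  | FAnd n of formula n & formula n : formula n
  | FOr n of formula n & formula n : formula n
  | FImp n of formula n & formula n : formula n
  | FEx n of formula n.+1 : formula n
  | FAll n of formula n.+1 : formula n
  | FBox n of formula n : formula n.

Arguments FBot {n}.

Definition FNot n (phi : formula n) : formula n := FImp phi FBot.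

Definition FNeq n (t u : term n) : formula n := FNot (FEq t u).

Fixpoint close (n : nat) : formula n -> formula 0 :=
  match n with
  | 0 => fun phi => phi
  | m.+1 => fun phi => close (FAll phi)
  end.

(** * The modal valuation *)

Section Valuation.
Variables (C : coding) (K : combinators C).

Fixpoint teval n (rho : n.-tuple carrier) (t : term n) : carrier :=
  match t with
  | TVar i => tnth rho i
  | TS => cs K
  | TK => ck K
  | TApp t1 t2 => app C (teval rho t1) (teval rho t2)
  end.

Definition eq_val (a b : carrier) : tval :=
  if `[< a = b >] then ttop else tbot.

Definition quant (c : carrier) : tval := [set c].

Fixpoint mu n (phi : formula n) : n.-tuple carrier -> tval -> tval :=
  match phi in formula n return n.-tuple carrier -> tval -> tval with
  | FEq _ t u => fun rho D => ominus C D (eq_val (teval rho t) (teval rho u))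
  | FBot _ => fun _ D => ominus C D tbot
  | FAnd _ phi1 phi2 => fun rho D => tand K (mu phi1 rho D) (mu phi2 rho D)
  | FOr _ phi1 phi2 => fun rho D =>
      ominus C D (tor K (mu phi1 rho D) (mu phi2 rho D))
  | FImp _ phi1 phi2 => fun rho D => timp C (mu phi1 rho D) (mu phi2 rho D)
  | FEx _ phi1 => fun rho D =>
      ominus C D (\bigcup_c tand K (quant c) (mu phi1 [tuple of c :: rho] D))
  | FAll _ phi1 => fun rho D =>
      \bigcap_c timp C (quant c) (mu phi1 [tuple of c :: rho] D)
  | FBox _ phi1 => fun rho D => ominus C D (\bigcap_E mu phi1 rho E)
  end.

Definition valid (phi : formula 0) : Prop :=
  exists e : carrier, forall D : tval, timp C ttop (mu phi [tuple] D) e.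

Definition stable n (phi : formula n) : Prop :=
  valid (FBox (close (FImp phi (FBox phi)))).

End Valuation.

(* The two variables of a formula with prefix "for all x, y". *)
Definition var_x : term 2 := TVar (inord 1).
Definition var_y : term 2 := TVar ord0.

(* Main.v *)
Require Import Defs.
From mathcomp Require Import all_boot all_classical.

Set Implicit Arguments.
Unset Strict Implicit.
Unset Printing Implicit Defensive.

(** A realizer of the stability of [x <> y] yields, once the outer box is
    removed ([box_realizer]), a single [f] such that, for all [a], [b] and [E],
    [f a b] maps [||a <> b||(E)] to [||box (a <> b)||(E)].  Application in the
    graph model is monotone, so [f set0 set0 g set0] is contained in
    [f set0 b g set0] for every [g].  The contradiction comes from choosing
    one [g], namely [g z x = z (k {0})], that is a realizer of both premises
    but for two values of the parameter:

    - For equal arguments, [||a <> a||(set0)] is empty, hence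
      [||box (a <> a)||(E)] is [top => E].  With [E] the collection of the sets
      containing [0], the element [g] realizes [a <> a] ([delay_eq]), and so
      [0] belongs to [f set0 set0 g set0].
    - For distinct arguments and [E = {set0}], the same [g] realizes [a <> b]
      ([delay_neq]), and [set0], being the constantly empty function, realizes
      [X => E] for every [X].  Hence [f set0 b g set0] is empty.

    Thus stability fails by monotonicity: the positive information that [0]
    belongs to the output cannot be withdrawn when [b] grows from [set0] to a
    different set. *)

Local Open Scope classical_set_scope.

Section GraphModel.
Variable C : coding.

Lemma app_subset (a a' b b' : carrier) :
  a `<=` a' -> b `<=` b' -> app C a b `<=` app C a' b'.
Proof.
move=> aa' bb' m [n [an nb]]; exists n; split; first exact: aa'.
exact: subset_trans nb bb'.
Qed.

Lemma app_set0 (b : carrier) : app C set0 b = set0.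
Proof. by apply/seteqP; split=> m // -[n []]. Qed.

End GraphModel.

Section Realizers.
Variables (C : coding) (K : combinators C).

Local Notation ap := (app C).

Definition neq_val (a b : carrier) (E : Defs.tval) : Defs.tval :=
  timp C (ominus C E (eq_val a b)) (ominus C E tbot).

Lemma mu_neq (a b : carrier) (E : Defs.tval) :
  mu K (FNeq var_x var_y) [tuple of b :: [tuple of a :: [tuple]]] E
  = neq_val a b E.
Proof. by rewrite /= !(tnth_nth set0) /= inordK. Qed.

(** The double negation in the clause for the box does not hide realizers: at
    the parameter [D] equal to the boxed truth value itself, the identity
    [s k k] realizes the premise. *)
Lemma box_realizer (phi : formula 0) :
  valid K (FBox phi) -> \bigcap_E mu K phi [tuple] E !=set0.
Proof.
move=> [e eP]; set X := \bigcap_E _.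
exists (ap (ap e set0) (ap (ap (cs K) (ck K)) (ck K))).
by apply: (eP X) => // x Xx; rewrite csP ckP.
Qed.

(** At the empty parameter [bot] has no realizer while every element realizes
    an equality that holds. *)
Lemma neq_val_refl (a : carrier) : neq_val a a set0 = set0.
Proof.
rewrite /neq_val /eq_val asboolT //; apply/seteqP; split=> // g gP.
by apply: (gP set0 _ set0) => // z zP; apply: zP (set0) I.
Qed.

Definition delay (c : carrier) : carrier :=
  ap (ap (cs K) (ap (ck K) (ck K)))
     (ap (ap (cs K) (ap (ap (cs K) (ck K)) (ck K))) (ap (ck K) (ap (ck K) c))).

Lemma delayE (c z x : carrier) :
  ap (ap (delay c) z) x = ap z (ap (ck K) c).
Proof. by rewrite /delay !(csP, ckP). Qed.

(** A realizer [z] of an equality that holds sends [top => E] to [E], and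
    [k c] lies in [top => E]. *)
Lemma delay_eq (c a : carrier) (E : Defs.tval) : E c -> neq_val a a E (delay c).
Proof.
rewrite /neq_val /eq_val asboolT // => Ec z zP x _; rewrite delayE.
by apply: zP => y _; rewrite ckP.
Qed.

(** When the equality fails, its realizers at [E] are the elements of
    [top => E]; evaluating one of them anywhere gives an element of [E], so
    [c] may lie outside of [E]. *)
Lemma delay_neq (c a b : carrier) (E : Defs.tval) :
  a <> b -> neq_val a b E (delay c).
Proof.
move=> ab; rewrite /neq_val /eq_val asboolF // => z zP x _.
by rewrite delayE; apply: zP.
Qed.

Lemma neq_not_stable : ~ stable K (FNeq var_x var_y).
Proof.
move=> /box_realizer[f fP].
have fab a b E g : neq_val a b E g ->
    ominus C E (\bigcap_F neq_val a b F) (ap (ap (ap f a) b) g).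
  rewrite -mu_neq; under eq_bigcapr do rewrite -mu_neq.
  exact: (fP E I a I a erefl b I b erefl g).
pose g := delay [set 0].
pose h b := ap (ap (ap (ap f set0) b) g) set0.
have h0 : h set0 0.
  (* The boxed value of [set0 <> set0] is empty, as its component at the empty
     parameter is, so that any element realizes the premise of [ominus]. *)
  have gP : neq_val set0 set0 [set v : carrier | v 0] g by exact: delay_eq.
  apply: (fab _ _ _ _ gP) => j jP.
  by have := jP set0 I; rewrite neq_val_refl.
have h1 : h [set 0] = set0.
  have ne : set0 <> [set 0] :> carrier.
    by move=> /seteqP[_ /(_ 0 erefl)].
  have gP : neq_val set0 [set 0] [set set0] g by exact: delay_neq.
  by apply: (fab _ _ _ _ gP) => j _; exact: app_set0.
suff : h [set 0] 0 by rewrite h1.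
by move: h0; do 3 ! [apply: app_subset => //].
Qed.

End Realizers.

Theorem proposition11p4 (C : coding) (K : combinators C) :
  [/\ ~ (forall (n : nat) (t u : term n), stable K (FNot (FEq t u))),
      ~ stable K (FNeq var_x var_y)
    & ~ valid K (FBox (FAll (FAll
          (FImp (FNeq var_x var_y) (FBox (FNeq var_x var_y))))))].
Proof.
split; last exact: neq_not_stable; last exact: neq_not_stable.
by move=> st; apply: (@neq_not_stable C K); apply: st.
Qed.
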